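(* Let $d$ be a positive integer and let $\mu>1$ be a constant. Then $$\max_{\substack{G\in\mathcal{G}_{\mu,d+1},\\ G\neq K_{d+1}}}\left\{\left\lfloor\frac{d+1}{\mathrm{rank}(A_G+\mu I)}\right\rfloor|V(G)|+q\right\}\ \le\ \max_{\substack{\frac{1-\beta}{\alpha-\beta}=\mu,\\ -1\le\beta<\alpha<1,\\ \beta<0}}N_{\alpha,\beta}(d)\ \le\ (d+1)\max_{G\in\mathcal{G}_{\mu,d+1}}\frac{|V(G)|}{\mathrm{rank}(A_G+\mu I)},$$ where, for each $G$, $q=q(G)=d+1-\mathrm{rank}(A_G+\mu I)\left\lfloor\frac{d+1}{\mathrm{rank}(A_G+\mu I)}\right\rfloor$.
   Context: Graphs are finite, simple and nonempty, considered up to isomorphism; $A_G$ is the adjacency matrix of $G$, $V(G)$ its vertex set, and $K_t$ is the complete graph on $t$ vertices. ${\rm j}$ is the all-ones column vector and $R(M)$ is the column space of a matrix $M$. $\mathcal{G}_{\mu,r}$ is the set of connected graphs $G$ such that the smallest eigenvalue of $A_G$ is at least $-\mu$, ${\rm j}\in R(A_G+\mu I)$, and $\mathrm{rank}(A_G+\mu I)\le r$. For $-1\le\beta<\alpha<1$, a spherical $\{\alpha,\beta\}$-code in $\mathbb{R}^d$ is a set $S$ of unit vectors in $\mathbb{R}^d$ such that $x^\top y\in\{\alpha,\beta\}$ for any two distinct $x,y\in S$ (it is allowed that only one of the values occurs), and $N_{\alpha,\beta}(d)$ is the maximum size of such a code. The middle maximum is over all pairs $(\alpha,\beta)$ of reals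 satisfying the displayed conditions. *)

(* Defs.v *)
From HB Require Import structures.
From mathcomp Require Import all_boot all_order all_algebra.
From mathcomp Require Import all_classical all_reals.

Set Implicit Arguments.
Unset Strict Implicit.
Unset Printing Implicit Defensive.

Import Order.TTheory GRing.Theory Num.Theory.

Local Open Scope classical_set_scope.
Local Open Scope ring_scope.

Definition is_max d (T : porderType d) (A : set T) (m : T) : Prop :=
  A m /\ ubound A m.

Definition is_min d (T : porderType d) (A : set T) (m : T) : Prop :=
  A m /\ lbound A m.

(* The vertex set may be empty here; [connected_graph] excludes that case. *)
Record sgraph := SGraph {
  vertex :> finType;
  edge : rel vertex;
  edge_sym : symmetric edge;
  edge_irr : irreflexive edge }.

Definition graph_iso (G H : sgraph) : Prop :=
  exists2 f : G -> H, bijective f & forall x y, edge (f x) (f y) = edge x y.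

Fact complete_sym t : symmetric [rel x y : 'I_t | x != y].
Proof. by move=> x y; rewrite /= eq_sym. Qed.

Fact complete_irr t : irreflexive [rel x y : 'I_t | x != y].
Proof. by move=> x; rewrite /= eqxx. Qed.

Definition complete_graph (t : nat) : sgraph :=
  SGraph (@complete_sym t) (@complete_irr t).

Definition connected_graph (G : sgraph) : Prop :=
  (0 < #|G|)%N /\ forall x y : G, connect (@edge G) x y.

Section Graphs.
Variable R : realType.

Definition adjmx (G : sgraph) : 'M[R]_#|G| :=
  \matrix_(i, j) (edge (enum_val i) (enum_val j))%:R.

Definition in_colspace m n (M : 'M[R]_(m, n)) (v : 'cV[R]_m) : bool :=
  (v^T <= M^T)%MS.

(* A real symmetric matrix has only real eigenvalues, so looking for
   eigenvalues in R loses nothing; [eigenvalue] uses row eigenvectors, which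
   makes no difference for a symmetric matrix. *)
Definition smallest_eigenvalue n (M : 'M[R]_n) (l : R) : Prop :=
  is_min [set a : R | eigenvalue M a] l.

Definition shifted (mu : R) (G : sgraph) : 'M[R]_#|G| := adjmx G + mu%:M.

(* A predicate rather than a [set sgraph]: the type of graphs is too large a
   universe for [set]. *)
Definition graph_class (mu : R) (r : nat) (G : sgraph) : Prop :=
  [/\ connected_graph G,
      exists2 l, smallest_eigenvalue (adjmx G) l & - mu <= l,
      in_colspace (shifted mu G) (const_mx 1)
    & (\rank (shifted mu G) <= r)%N].

End Graphs.

Section Codes.
Variable R : realType.

Definition dot d (x y : 'cV[R]_d) : R := (x^T *m y) 0 0.

Definition spherical_code d (alpha beta : R) (S : set 'cV[R]_d) : Prop :=
  (forall x, S x -> dot x x = 1) /\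
  (forall x y, S x -> S y -> x <> y -> dot x y = alpha \/ dot x y = beta).

Definition code_sizes (alpha beta : R) (d : nat) : set nat :=
  [set n | exists2 S : set 'cV[R]_d,
     spherical_code alpha beta S & (S #= `I_n)%card].

(* N_{alpha,beta}(d); the default value 0 is only taken when the set of code
   sizes has no maximum. *)
Definition max_code (alpha beta : R) (d : nat) : nat :=
  xget 0%N (is_max (code_sizes alpha beta d)).

Definition admissible (mu alpha beta : R) : Prop :=
  [/\ (1 - beta) / (alpha - beta) = mu,
      -1 <= beta, beta < alpha, alpha < 1 & beta < 0].

End Codes.

(* Main.v *)
(* A spherical {alpha, beta}-code with beta < 0 and (1 - beta)/(alpha - beta) = mu
   is the same thing as a graph with M = A + mu I positive semidefinite,
   rank M <= d + 1, j in the column space of M, and s mu >= 2 where s = <j, w>,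
   M w = j.  One way, M = (Gram - beta J)/(alpha - beta); the other way, M - J/s is
   positive semidefinite of rank one less, and is a multiple of a Gram matrix.
   Upper bound: rank, positivity and "j in the column space" split over connected
   components.  Lower bound: take floor((d+1)/rank) copies of G and q copies of
   K_1; two non-adjacent vertices give s mu >= 2, and they exist unless
   G = K_(d+1).  All maxima are attained because |V(G)| <= 4^rank M. *)
Require Import Defs.
From HB Require Import structures.
From mathcomp Require Import all_boot all_order all_algebra.
From mathcomp Require Import all_classical all_reals.
From mathcomp Require Import ring lra zify.

Set Implicit Arguments.
Unset Strict Implicit.
Unset Printing Implicit Defensive.

Import Order.TTheory GRing.Theory Num.Theory.

Local Open Scope classical_set_scope.
Local Open Scope ring_scope.

(** * Positive semidefinite matrices: Gram matrices and rank-one deflation *)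

Section PositiveSemidefinite.
Variable R : realFieldType.

Definition form n (M : 'M[R]_n) (x y : 'rV[R]_n) : R := (x *m M *m y^T) 0 0.

Definition psd n (M : 'M[R]_n) : Prop :=
  M^T = M /\ forall x, 0 <= form M x x.

Lemma formDl n (M : 'M[R]_n) x y z : form M (x + y) z = form M x z + form M y z.
Proof. by rewrite /form !mulmxDl mxE. Qed.

Lemma formZl n (M : 'M[R]_n) a x z : form M (a *: x) z = a * form M x z.
Proof. by rewrite /form -!scalemxAl mxE. Qed.

Lemma formC n (M : 'M[R]_n) x y : M^T = M -> form M x y = form M y x.
Proof.
move=> sM; have e : (x *m M *m y^T)^T = y *m M *m x^T.
  by rewrite !trmx_mul trmxK sM mulmxA.
by rewrite /form -e [RHS]mxE.
Qed.

Lemma form_comb n (M : 'M[R]_n) x y a : M^T = M ->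
  form M (x + a *: y) (x + a *: y) =
  form M x x + 2 * a * form M x y + a ^+ 2 * form M y y.
Proof.
move=> sM; rewrite formDl formZl.
rewrite -(formC (_ + _) x sM) -(formC (_ + _) y sM) !formDl !formZl.
by rewrite (formC y x sM); ring.
Qed.

Lemma form_delta n (M : 'M[R]_n) i j :
  form M (delta_mx 0 i) (delta_mx 0 j) = M i j.
Proof. by rewrite /form -rowE trmx_delta -colE !mxE. Qed.

Lemma formE n (M : 'M[R]_n) x y :
  form M x y = \sum_i \sum_j x 0 j * M j i * y 0 i.
Proof.
rewrite /form mxE; apply: eq_bigr => i _.
by rewrite !mxE big_distrl.
Qed.

Lemma formDm n (M N : 'M[R]_n) x y : form (M + N) x y = form M x y + form N x y.
Proof. by rewrite /form mulmxDr mulmxDl mxE. Qed.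

Lemma formZm n (M : 'M[R]_n) a x y : form (a *: M) x y = a * form M x y.
Proof. by rewrite /form -scalemxAr -scalemxAl mxE. Qed.

Lemma form_scalar n a (x : 'rV[R]_n) :
  form a%:M x x = a * form 1%:M x x.
Proof. by rewrite -formZm scalemx1. Qed.

Lemma form1E n (x : 'rV[R]_n) : form 1%:M x x = \sum_i x 0 i ^+ 2.
Proof.
by rewrite /form mulmx1 mxE; apply: eq_bigr => i _; rewrite mxE expr2.
Qed.

Lemma form1_ge0 n (x : 'rV[R]_n) : 0 <= form 1%:M x x.
Proof. by rewrite form1E sumr_ge0 // => i _; rewrite sqr_ge0. Qed.

Lemma form1_eq0 n (x : 'rV[R]_n) : (form 1%:M x x == 0) = (x == 0).
Proof.
apply/eqP/eqP => [|->]; last by rewrite /form !mul0mx mxE.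
rewrite form1E => /psumr_eq0P h; apply/rowP => i; rewrite mxE.
by apply/eqP; rewrite -sqrf_eq0 h // => j _; rewrite sqr_ge0.
Qed.

Lemma form_gram n k (Y : 'M[R]_(n, k)) (x : 'rV[R]_n) :
  form (Y *m Y^T) x x = form 1%:M (x *m Y) (x *m Y).
Proof. by rewrite /form mulmx1 trmx_mul !mulmxA. Qed.

Lemma psd_gram n k (Y : 'M[R]_(n, k)) : psd (Y *m Y^T).
Proof.
by split=> [|x]; [rewrite trmx_mul trmxK | rewrite form_gram form1_ge0].
Qed.

Lemma mulmx_tr_eq0 n k (Y : 'M[R]_(n, k)) : Y *m Y^T = 0 -> Y = 0.
Proof.
move=> Y0; apply/row_matrixP => i; rewrite row0 rowE.
apply/eqP; rewrite -form1_eq0 -form_gram Y0 /form mulmx0 mul0mx mxE //.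
Qed.

(** If Y Y^T C = 0, then C^T Y has zero Gram matrix, so it vanishes itself. This allows preimages
    under [Y] to be lifted to preimages under [Y *m Y^T]. *)
Lemma gram_colspace n k (Y : 'M[R]_(n, k)) : (Y^T <= Y *m Y^T)%MS.
Proof.
rewrite submxE; set C := cokermx _; apply/eqP; apply: trmx_inj; rewrite trmx0.
apply: mulmx_tr_eq0; rewrite trmxK trmx_mul trmxK -mulmxA [Y *m _]mulmxA.
by rewrite mulmx_coker mulmx0.
Qed.

Lemma psd_scalar n (a : R) : 0 <= a -> psd (a%:M : 'M_n).
Proof.
by move=> a0; split=> [|x]; rewrite ?tr_scalar_mx // form_scalar mulr_ge0 ?form1_ge0.
Qed.

Lemma psdD n (M N : 'M[R]_n) : psd M -> psd N -> psd (M + N).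
Proof.
move=> [sM pM] [sN pN]; split=> [|x]; first by rewrite linearD /= sM sN.
by rewrite formDm addr_ge0.
Qed.

Lemma mxsub_mulmx m1 m2 n1 n2 (f : 'I_m2 -> 'I_m1) (g : 'I_n2 -> 'I_n1)
    (A : 'M[R]_(m1, n1)) :
  mxsub f g A = rowsub f 1%:M *m A *m colsub g 1%:M.
Proof. by rewrite mul_rowsub_mx mul1mx mulmx_colsub mulmx1 -mxsubcr. Qed.

Lemma psd_mxsub m n (f : 'I_m -> 'I_n) (M : 'M[R]_n) :
  psd M -> psd (mxsub f f M).
Proof.
move=> [sM pM]; split=> [|x]; first by rewrite trmx_mxsub sM.
rewrite mxsub_mulmx -{2}[1%:M]trmx1 -trmx_mxsub.
have -> : form (rowsub f 1%:M *m M *m (rowsub f 1%:M)^T) x x =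
  form M (x *m rowsub f 1%:M) (x *m rowsub f 1%:M).
  by rewrite /form trmx_mul !mulmxA.
exact: pM.
Qed.

(** The rank-one reduction of [M] that puts [w] in the kernel; for a basis vector [w] it is a Schur
    complement padded with zeros. *)
Definition deflate n (M : 'M[R]_n) w : 'M[R]_n :=
  M - (form M w w)^-1 *: (M *m w^T *m (w *m M)).

Lemma form_deflate n (M : 'M[R]_n) w x : M^T = M ->
  form (deflate M w) x x = form M x x - (form M w w)^-1 * form M x w ^+ 2.
Proof.
move=> sM; rewrite /deflate formDm -scaleNr formZm mulNr; congr (_ - _ * _).
rewrite expr2 {2}(formC x w sM) /form.
have -> : x *m (M *m w^T *m (w *m M)) *m x^T = (x *m M *m w^T) *m (w *m M *m x^T).
  by rewrite !mulmxA.
by rewrite mxE big_ord1.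
Qed.

(* The value of the deflated form at x is that of M at x - (M(x,w)/M(w,w)) w. *)
Lemma psd_deflate n (M : 'M[R]_n) w : psd M -> 0 < form M w w ->
  psd (deflate M w).
Proof.
move=> [sM pM] s0; split=> [|x].
  by rewrite /deflate linearB linearZ /= !trmx_mul trmxK sM.
rewrite form_deflate //.
have := pM (x + (- (form M x w / form M w w)) *: w).
rewrite form_comb //; congr (0 <= _).
by field; rewrite gt_eqF.
Qed.

(** The row space does not grow. If the rank stayed the same, [M] would be a left multiple of the
    deflated matrix, which kills [w], against M(w,w) > 0. *)
Lemma rank_deflate n (M : 'M[R]_n) w : M^T = M -> 0 < form M w w ->
  (\rank (deflate M w) < \rank M)%N.
Proof.
move=> sM s0.
have w0 : w *m deflate M w = 0.
  rewrite /deflate mulmxBr -scalemxAr !mulmxA.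
  rewrite [w *m M *m w^T]mx11_scalar -/(form M w w) -mulmxA mul_scalar_mx scalerA.
  by rewrite mulVf ?gt_eqF // scale1r subrr.
have sub : (deflate M w <= M)%MS.
  rewrite /deflate scalemxAl mulmxA -{1}[M]mul1mx -mulmxBl; exact: submxMl.
rewrite ltnNge; apply/negP => le.
have /andP[_ /submxP[D eD]] : (deflate M w == M)%MS.
  by rewrite -mxrank_leqif_eq // eqn_leq le mxrankS.
have sD : (deflate M w)^T = deflate M w.
  by rewrite /deflate linearB linearZ /= !trmx_mul trmxK sM.
have : form M w w = 0.
  by rewrite /form -mulmxA {1}eD -mulmxA -[deflate _ _ *m _]trmxK trmx_mul trmxK sD w0 trmx0 !mulmx0 mxE.
by move/eqP; rewrite gt_eqF.
Qed.

Lemma psd_diag_ge0 n (M : 'M[R]_n) i : psd M -> 0 <= M i i.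
Proof. by case=> _ /(_ (delta_mx 0 i)); rewrite form_delta. Qed.

(** With a zero diagonal, the form at e_i + e_j and e_i - e_j is 2 M_ij and -2 M_ij, so every entry
    vanishes. *)
Lemma psd_neq0_diag n (M : 'M[R]_n) : psd M -> M != 0 -> exists i, 0 < M i i.
Proof.
move=> pM M0; apply/existsP; apply: contraNT M0; rewrite negb_exists.
move=> /forallP h; have d0 i : M i i = 0.
  by apply/eqP; rewrite eq_le psd_diag_ge0 // andbT leNgt.
apply/eqP/matrixP => i j; rewrite mxE.
case: pM => sM pM.
have := pM (delta_mx 0 i + 1 *: delta_mx 0 j).
have := pM (delta_mx 0 i + (-1) *: delta_mx 0 j).
by rewrite !form_comb // !form_delta !d0; lra.
Qed.

End PositiveSemidefinite.

(* Deflating along a basis vector with positive diagonal entry splits off one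
   coordinate of the Gram vectors and lowers the rank. *)
Lemma psd_factor (R : rcfType) n d (M : 'M[R]_n) : psd M -> (\rank M <= d)%N ->
  exists Y : 'M_(n, d), M = Y *m Y^T.
Proof.
elim: d M => [|d IHd] M pM rM.
  exists 0; rewrite mul0mx; apply/eqP; rewrite -mxrank_eq0; lia.
have [->|M0] := eqVneq M 0; first by exists 0; rewrite mul0mx.
have [i Mi] := psd_neq0_diag pM M0.
pose w : 'rV[R]_n := delta_mx 0 i.
have s0 : 0 < form M w w by rewrite form_delta.
have [] := IHd _ (psd_deflate pM s0).
  by rewrite -ltnS; apply: leq_trans (rank_deflate pM.1 s0) rM.
move=> Z eZ.
pose Y : 'M_(n, 1 + d) := row_mx (Num.sqrt (form M w w)^-1 *: (M *m w^T)) Z.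
suff eY : M = Y *m Y^T by exists Y.
rewrite tr_row_mx mul_row_col -eZ linearZ /= -scalemxAl -scalemxAr scalerA.
rewrite -expr2 sqr_sqrtr ?invr_ge0 ?ltW // trmx_mul trmxK pM.1.
by rewrite /deflate addrC subrK.
Qed.

(** * The smallest eigenvalue of a real symmetric matrix *)

Section SmallestEigenvalue.
Variable R : realType.

Lemma form_bound n (M : 'M[R]_n) : exists2 C, 0 < C &
  forall x, `|form M x x| <= C * form 1%:M x x.
Proof.
(* The sum of the absolute entries suffices, as |x_i x_j| <= |x|^2; adding 1 makes the constant
   positive even for the zero matrix. *)
exists (1 + \sum_i \sum_j `|M j i|) => [|x].
  by rewrite ltr_pwDl // sumr_ge0 // => i _; rewrite sumr_ge0.
rewrite mulrDl mul1r -[leLHS]add0r lerD ?form1_ge0 // formE.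
apply: le_trans (ler_norm_sum _ _ _) _; rewrite mulr_suml ler_sum // => i _.
apply: le_trans (ler_norm_sum _ _ _) _; rewrite mulr_suml ler_sum // => j _.
rewrite !normrM mulrAC mulrC ler_wpM2l //.
have le2 k : `|x 0 k| ^+ 2 <= form 1%:M x x.
  rewrite form1E (bigD1 k) //= real_normK ?num_real // lerDl.
  by rewrite sumr_ge0 // => l _; rewrite sqr_ge0.
have := le2 i; have := le2 j.
have : 0 <= (`|x 0 j| - `|x 0 i|) ^+ 2 by rewrite sqr_ge0.
nra.
Qed.

(** With |M^-1(x,x)| <= C |x|^2, nonnegativity of the form at x - C^-1 x M^-1 reads M(x,x) >= 2 C^-1
    |x|^2 - C^-2 M^-1(x,x), and the right side is at least C^-1 |x|^2. *)
Lemma psd_unit_lower n (M : 'M[R]_n) : psd M -> M \in unitmx ->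
  exists2 e, 0 < e & psd (M - e%:M).
Proof.
move=> [sM pM] uM; have [C C0 hC] := form_bound (invmx M).
exists C^-1; first by rewrite invr_gt0.
split=> [|x]; first by rewrite linearB /= tr_scalar_mx sM.
have sI : (invmx M)^T = invmx M by rewrite trmx_inv sM.
rewrite -scaleN1r formDm formZm form_scalar.
have := pM (x + (- C^-1) *: (x *m invmx M)).
rewrite form_comb //.
have -> : form M x (x *m invmx M) = form 1%:M x x.
  by rewrite /form mulmx1 trmx_mul sI mulmxA mulmxK.
have -> : form M (x *m invmx M) (x *m invmx M) = form (invmx M) x x.
  by rewrite /form mulmxKV // trmx_mul sI mulmxA.
have := le_trans (ler_norm _) (hC x) => h.
have : C^-1 ^+ 2 * form (invmx M) x x <= C^-1 * form 1%:M x x.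
  apply: le_trans (ler_wpM2l _ h) _; first by rewrite sqr_ge0.
  by rewrite mulrA expr2 mulfVK ?gt_eqF.
lra.
Qed.

(* The witness is the supremum of the t such that M - t I is positive
   semidefinite; if M - t I were invertible there, t could be increased. *)
Lemma smallest_eigenvalue_ex n (M : 'M[R]_n) : (0 < n)%N -> M^T = M ->
  exists2 l, smallest_eigenvalue M l & psd (M - l%:M).
Proof.
case: n M => // n M _ sM.
pose E := [set t | psd (M - t%:M)].
have symE t : (M - t%:M)^T = M - t%:M by rewrite linearB /= tr_scalar_mx sM.
have formB t x : form (M - t%:M) x x = form M x x - t * form 1%:M x x.
  by rewrite -scaleN1r formDm formZm form_scalar mulN1r.
have E0 : E !=set0.
  have [C _ hC] := form_bound M; exists (- C); split=> // x.
  rewrite formB mulNr opprK.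
  by have := hC x; rewrite ler_norml => /andP[]; lra.
(* Every Rayleigh quotient bounds [E] from above; hence the supremum lies below all of them and
   belongs to [E]. *)
have Eub x : x != 0 -> ubound E (form M x x / form 1%:M x x).
  move=> x0 t [_ /(_ x)]; rewrite formB subr_ge0.
  by rewrite ler_pdivlMr // lt_def form1_eq0 x0 form1_ge0.
have d0 : delta_mx 0 0 != 0 :> 'rV[R]_n.+1.
  by apply/eqP => /rowP/(_ 0)/eqP; rewrite !mxE !eqxx oner_eq0.
have supE : has_sup E by split=> //; eexists; exact: Eub d0.
have pl : psd (M - (sup E)%:M).
  split=> // x; rewrite formB subr_ge0.
  have [->|x0] := eqVneq x 0; first by rewrite /form !mul0mx !mxE mulr0.
  rewrite -ler_pdivlMr ?lt_def ?form1_eq0 ?x0 ?form1_ge0 //.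
  by apply: ge_sup => //; apply: Eub.
exists (sup E) => //; split.
  rewrite /= -[eigenvalue _ _]negbK; apply/negP => nev.
  have u : M - (sup E)%:M \in unitmx.
    by rewrite -row_free_unit -kermx_eq0 -[_ == _]negbK.
  have [e e0 pe] := psd_unit_lower pl u.
  suff : sup E + e <= sup E by rewrite gerDl leNgt e0.
  by apply: sup_upper_bound => //; rewrite /E /= [(_ + _)%:M]raddfD opprD addrA.
move=> a /eigenvalueP[v va v0].
have e : form M v v = a * form 1%:M v v.
  by rewrite /form va -scalemxAl mxE mulmx1.
have := pl.2 v; rewrite formB subr_ge0 e ler_pM2r //.
by rewrite lt_def form1_eq0 v0 form1_ge0.
Qed.

End SmallestEigenvalue.

(** * Positive semidefinite matrices whose column space contains j *)

Section Feasible.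
Variable R : realFieldType.

Lemma rank_mxsub m1 m2 n1 n2 (f : 'I_m2 -> 'I_m1) (g : 'I_n2 -> 'I_n1)
    (A : 'M[R]_(m1, n1)) :
  (\rank (mxsub f g A) <= \rank A)%N.
Proof.
rewrite mxsub_mulmx; apply: leq_trans (mxrankM_maxl _ _) _.
exact: mxrankM_maxr.
Qed.

(** The part of [graph_class] that passes to and from disjoint unions; connectedness and the rank
    bound are kept apart. *)
Definition feasible n (M : 'M[R]_n) : Prop :=
  psd M /\ exists w : 'cV_n, M *m w = const_mx 1.

Lemma feasible_mxsub m n (f : 'I_m -> 'I_n) (M : 'M[R]_n) :
  bijective f -> feasible M -> feasible (mxsub f f M).
Proof.
move=> bf [pM [w Mw]]; split; first exact: psd_mxsub.
exists (rowsub f w); apply/colP => i; rewrite !mxE.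
have /colP/(_ (f i)) := Mw; rewrite !mxE => <-.
rewrite [RHS](reindex f) /=; last exact: onW_bij.
by apply: eq_bigr => j _; rewrite !mxE.
Qed.

Lemma feasible_block m n (A : 'M[R]_m) (B : 'M[R]_n) :
  feasible (block_mx A 0 0 B) <-> feasible A /\ feasible B.
Proof.
split=> [[pM [w Mw]]|[[pA [u Au]] [pB [v Bv]]]].
  split; split.
  - have -> : A = mxsub (lshift n) (lshift n) (block_mx A 0 0 B).
      by apply/matrixP => i j; rewrite mxE block_mxEul.
    exact: psd_mxsub.
  - exists (usubmx w); apply/colP => i.
    have /colP/(_ (lshift n i)) := Mw.
    by rewrite -{1}[w]vsubmxK mul_block_col !mul0mx addr0 add0r col_mxEu !mxE.
  - have -> : B = mxsub (@rshift m n) (@rshift m n) (block_mx A 0 0 B).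
      by apply/matrixP => i j; rewrite mxE block_mxEdr.
    exact: psd_mxsub.
  - exists (dsubmx w); apply/colP => i.
    have /colP/(_ (rshift m i)) := Mw.
    by rewrite -{1}[w]vsubmxK mul_block_col !mul0mx addr0 add0r col_mxEd !mxE.
split; last first.
  exists (col_mx u v).
  by rewrite mul_block_col !mul0mx addr0 add0r Au Bv col_mx_const.
split=> [|x]; first by rewrite tr_block_mx !trmx0 pA.1 pB.1.
rewrite -[x]hsubmxK /form mul_row_block !mulmx0 addr0 add0r tr_row_mx mul_row_col.
by rewrite mxE addr_ge0 ?pA.2 ?pB.2.
Qed.

End Feasible.

Lemma in_colspaceP (R : realType) m n (M : 'M[R]_(m, n)) v :
  in_colspace M v <-> exists w : 'cV_n, M *m w = v.
Proof.
split=> [/submxP[D eD]|[w <-]]; last by rewrite /in_colspace trmx_mul submxMl.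
by exists D^T; apply: trmx_inj; rewrite trmx_mul trmxK.
Qed.

(** * Disjoint unions and induced subgraphs *)

Section SumGraph.
Variables G1 G2 : sgraph.

Definition sum_edge : rel (G1 + G2)%type := fun u v =>
  match u, v with
  | inl x, inl y => edge x y
  | inr x, inr y => edge x y
  | _, _ => false
  end.

Fact sum_edge_sym : symmetric sum_edge.
Proof. by move=> [x|x] [y|y] //=; rewrite edge_sym. Qed.

Fact sum_edge_irr : irreflexive sum_edge.
Proof. by move=> [x|x] /=; apply: edge_irr. Qed.

Definition sum_graph : sgraph := SGraph sum_edge_sym sum_edge_irr.

(** A numbering that lists [G1] before [G2], chosen to make the matrix of the union block
    diagonal. *)
Definition sum_enum (i : 'I_(#|G1| + #|G2|)) : sum_graph :=
  match fintype.split i with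
  | inl a => inl (enum_val a)
  | inr b => inr (enum_val b)
  end.

Lemma sum_enum_bij : bijective sum_enum.
Proof.
exists (fun u : sum_graph => match u with
  | inl x => lshift _ (enum_rank x)
  | inr y => rshift _ (enum_rank y)
  end) => [i|[x|x]]; rewrite /sum_enum.
- by case: (split_ordP i) => j ->; rewrite enum_valK.
- by rewrite (unsplitK (inl (enum_rank x))) enum_rankK.
- by rewrite (unsplitK (inr (enum_rank x))) enum_rankK.
Qed.

End SumGraph.

Section Induced.
Variables (G : sgraph) (a : pred G).

Definition induced_edge : rel {x : G | a x} := fun x y => edge (val x) (val y).

Fact induced_edge_sym : symmetric induced_edge.
Proof. by move=> x y; apply: edge_sym. Qed.

Fact induced_edge_irr : irreflexive induced_edge.
Proof. by move=> x; apply: edge_irr. Qed.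

Definition induced : sgraph := SGraph induced_edge_sym induced_edge_irr.

Lemma card_induced : #|induced| = #|a|.
Proof. exact: card_sig. Qed.

End Induced.

Lemma closed_iso_sum (G : sgraph) (a : pred G) : closed (@edge G) a ->
  graph_iso (sum_graph (induced a) (induced (predC a))) G.
Proof.
move=> ca; pose f (u : sum_graph (induced a) (induced (predC a))) : G :=
  match u with inl x => val x | inr x => val x end.
exists f.
  apply: inj_card_bij => [[x|x] [y|y] /= /eqP h|].
  - by congr inl; apply/val_inj/eqP.
  - by have := valP y; rewrite /= -(eqP h) (valP x).
  - by have := valP x; rewrite /= (eqP h) (valP y).
  - by congr inr; apply/val_inj/eqP.
  by rewrite card_sum !card_induced cardC.
move=> [x|x] [y|y] //=; apply/negP => /ca; rewrite !unfold_in => e.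
  by have := valP y; rewrite /= -e (valP x).
by have := valP x; rewrite /= e (valP y).
Qed.

(** * The matrix A + mu I of a graph: renumbering, unions, rank *)

Section ShiftedAdjacency.
Variables (R : realType) (mu : R).

(** A + mu I for an arbitrary numbering of the vertices, whereas [shifted] is tied to [enum_val]. *)
Definition enum_shifted (G : sgraph) n (e : 'I_n -> G) : 'M[R]_n :=
  \matrix_(i, j) ((edge (e i) (e j))%:R + mu *+ (e i == e j)).

Lemma shiftedE (G : sgraph) (i j : 'I_#|G|) : shifted mu G i j =
  (edge (enum_val i) (enum_val j))%:R + mu *+ (enum_val i == enum_val j).
Proof. by rewrite !mxE (inj_eq enum_val_inj). Qed.

Lemma shifted_rank (G : sgraph) (x y : G) :
  shifted mu G (enum_rank x) (enum_rank y) = (edge x y)%:R + mu *+ (x == y).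
Proof. by rewrite shiftedE !enum_rankK. Qed.

Lemma adjmx_tr (G : sgraph) : (adjmx R G)^T = adjmx R G.
Proof. by apply/matrixP => i j; rewrite !mxE edge_sym. Qed.

Lemma enum_shifted_mxsub (G : sgraph) n (e : 'I_n -> G) :
  enum_shifted e = mxsub (enum_rank \o e) (enum_rank \o e) (shifted mu G).
Proof. by apply/matrixP => i j; rewrite !mxE /= -shifted_rank !mxE. Qed.

Lemma shifted_mxsub (G : sgraph) n (e : 'I_n -> G) f : cancel f e ->
  shifted mu G = mxsub (f \o enum_val) (f \o enum_val) (enum_shifted e).
Proof.
by move=> fK; apply/matrixP => i j; rewrite shiftedE !mxE /= !fK.
Qed.

Lemma rank_enum_shifted (G : sgraph) n (e : 'I_n -> G) : bijective e ->
  \rank (enum_shifted e) = \rank (shifted mu G).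
Proof.
case=> f eK fK; apply/eqP; rewrite eqn_leq {1}enum_shifted_mxsub rank_mxsub /=.
by rewrite (shifted_mxsub fK) rank_mxsub.
Qed.

Lemma feasible_enum_shifted (G : sgraph) n (e : 'I_n -> G) : bijective e ->
  feasible (enum_shifted e) <-> feasible (shifted mu G).
Proof.
move=> be; have [f eK fK] := be; split.
  rewrite (shifted_mxsub fK); apply: feasible_mxsub.
  by apply: bij_comp; [exists e | exact: enum_val_bij].
rewrite enum_shifted_mxsub; apply: feasible_mxsub.
by apply: bij_comp => //; exact: enum_rank_bij.
Qed.

Lemma iso_shifted (G H : sgraph) (f : G -> H) : injective f ->
  (forall x y, edge (f x) (f y) = edge x y) ->
  enum_shifted (f \o (enum_val : 'I_#|G| -> G)) = shifted mu G.
Proof.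
by move=> fI fE; apply/matrixP => i j; rewrite shiftedE mxE /= fE (inj_eq fI).
Qed.

Lemma rank_iso (G H : sgraph) : graph_iso G H ->
  \rank (shifted mu G) = \rank (shifted mu H).
Proof.
case=> f bf fE; rewrite -(iso_shifted (bij_inj bf) fE) rank_enum_shifted //.
by apply: bij_comp => //; exact: enum_val_bij.
Qed.

Lemma feasible_iso (G H : sgraph) : graph_iso G H ->
  feasible (shifted mu G) <-> feasible (shifted mu H).
Proof.
case=> f bf fE; rewrite -(iso_shifted (bij_inj bf) fE).
by apply: feasible_enum_shifted; apply: bij_comp => //; exact: enum_val_bij.
Qed.

Lemma sum_shifted (G1 G2 : sgraph) : enum_shifted (@sum_enum G1 G2) =
  block_mx (shifted mu G1) 0 0 (shifted mu G2).
Proof.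
apply/matrixP => i j; rewrite mxE /sum_enum.
case: (split_ordP i) => i' ->; case: (split_ordP j) => j' ->;
  rewrite ?block_mxEul ?block_mxEur ?block_mxEdl ?block_mxEdr;
  by rewrite ?shiftedE ?mxE ?add0r.
Qed.

Lemma rank_sum_graph (G1 G2 : sgraph) : \rank (shifted mu (sum_graph G1 G2)) =
  (\rank (shifted mu G1) + \rank (shifted mu G2))%N.
Proof.
by rewrite -(rank_enum_shifted (@sum_enum_bij G1 G2)) sum_shifted rank_diag_block_mx.
Qed.

Lemma feasible_sum_graph (G1 G2 : sgraph) :
  feasible (shifted mu (sum_graph G1 G2)) <->
  feasible (shifted mu G1) /\ feasible (shifted mu G2).
Proof.
rewrite -feasible_block -sum_shifted.
by split=> /(feasible_enum_shifted (@sum_enum_bij G1 G2)).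
Qed.

(** For the smallest eigenvalue l, A - l I is positive semidefinite, so l >= - mu makes A + mu I so
    too; conversely the form of A + mu I at an eigenvector v of l is (l + mu) |v|^2. *)
Lemma graph_classP r (G : sgraph) : graph_class mu r G <->
  [/\ connected_graph G, feasible (shifted mu G) & (\rank (shifted mu G) <= r)%N].
Proof.
have shE l : shifted mu G = (adjmx R G - l%:M) + (l + mu)%:M.
  by rewrite [(_ + _)%:M]raddfD addrA subrK.
split=> [[cG [l [lE lb] mul] /in_colspaceP wG rG]|[cG [pG /in_colspaceP wG] rG]];
  have [l' [l'E lb'] pl'] := smallest_eigenvalue_ex cG.1 (adjmx_tr G).
  split=> //; split=> //; rewrite (shE l'); apply: psdD => //.
  by apply: psd_scalar; have := lb _ l'E; lra.
split=> //; exists l' => //.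
have /eigenvalueP[v va v0] := l'E.
have p0 : 0 < form 1%:M v v by rewrite lt_def form1_eq0 v0 form1_ge0.
have := pG.2 v; rewrite /shifted formDm form_scalar.
have -> : form (adjmx R G) v v = l' * form 1%:M v v.
  by rewrite /form va -scalemxAl mxE mulmx1.
by rewrite -mulrDl pmulr_lge0 //; lra.
Qed.

Lemma rank_shifted_gt0 (G : sgraph) : mu != 0 -> (0 < #|G|)%N ->
  (0 < \rank (shifted mu G))%N.
Proof.
move=> mu0 /card_gt0P[x _]; rewrite lt0n mxrank_eq0; apply/eqP => M0.
have := shifted_rank x x; rewrite M0 mxE eqxx edge_irr add0r mulr1n.
by move/eqP; rewrite eq_sym (negbTE mu0).
Qed.

(* A column is determined by its entries in a maximal independent set of rows,
   and two equal columns would force an off-diagonal entry equal to mu. *)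
Lemma card_le_rank (G : sgraph) : 1 < mu ->
  (#|G| <= 4 ^ \rank (shifted mu G))%N.
Proof.
move=> mu1; set M := shifted mu G; set f := maxrankfun M.
(* Two bits determine an entry of a column, namely adjacency and being on the diagonal; hence the
   base 4. *)
pose code (j : 'I_#|G|) : {ffun 'I_(\rank M) -> bool * bool} :=
  [ffun i => (edge (enum_val (f i)) (enum_val j), f i == j)].
suff codeI : injective code.
  have := leq_card _ codeI.
  by rewrite card_ffun card_prod card_bool !card_ord.
move=> j k /ffunP ejk.
have /submxP[D eD] : (M <= rowsub f M)%MS by rewrite eq_maxrowsub.
have eM i : M i j = M i k.
  rewrite eD !mxE; apply: eq_bigr => l _; congr (_ * _).
  have := ejk l; rewrite !ffunE => -[e1 e2].
  by rewrite [LHS]mxE [RHS]mxE !shiftedE !(inj_eq enum_val_inj) e1 e2.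
apply/eqP; apply: contraT => jk; have := eM j.
rewrite !shiftedE !(inj_eq enum_val_inj) eqxx (negbTE jk) edge_irr.
by case: edge => /=; lra.
Qed.

(** Here A + mu I = J + (mu - 1) I is positive definite, hence invertible. *)
Lemma feasible_complete (G : sgraph) : 1 < mu ->
  (forall x y : G, x != y -> edge x y) ->
  feasible (shifted mu G) /\ \rank (shifted mu G) = #|G|.
Proof.
move=> mu1 cG; set M := shifted mu G.
have eM : M = const_mx 1 *m (const_mx 1 : 'cV_#|G|)^T + (mu - 1)%:M.
  apply/matrixP => i j; rewrite shiftedE !mxE big_ord1 !mxE (inj_eq enum_val_inj).
  have [->|ij] := eqVneq i j; first by rewrite edge_irr /= !mulr1n; ring.
  by rewrite cG ?(inj_eq enum_val_inj) // /= !mulr0n; ring.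
have form_gt0 x : x != 0 -> 0 < form M x x.
  move=> x0; rewrite eM formDm form_scalar ltr_wpDl ?(psd_gram _).2 //.
  by rewrite mulr_gt0 ?subr_gt0 // lt_def form1_eq0 x0 form1_ge0.
have pM : psd M by rewrite eM; apply: psdD (psd_gram _) (psd_scalar _ _); lra.
have fM : row_free M.
  rewrite -kermx_eq0; apply/rowV0P => x /sub_kermxP xM.
  apply/eqP; apply: contraT => /form_gt0.
  by rewrite /form xM mul0mx mxE ltxx.
split; last exact/eqP.
split=> //; exists (invmx M *m const_mx 1).
by rewrite mulKVmx // -row_free_unit.
Qed.

End ShiftedAdjacency.

(** Strong induction on the number of vertices: a disconnected graph splits into the component of a
    vertex and the rest, and both the number of vertices and the rank add up. *)
Lemma feasible_card (R : realType) (mu : R) r (c : R) : 0 <= c ->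
  (forall G, graph_class mu r G -> #|G|%:R <= (\rank (shifted mu G))%:R * c) ->
  forall G, feasible (shifted mu G) -> (\rank (shifted mu G) <= r)%N ->
  #|G|%:R <= (\rank (shifted mu G))%:R * c.
Proof.
move=> c0 hc G; have [n] := ubnP #|G|; elim: n G => // n IHn G ltGn fG rG.
(* The empty graph is not connected by definition, so it is treated apart. *)
have [G0|G0] := posnP #|G|.
  by apply: (@le_trans _ _ 0); rewrite ?mulr_ge0 // G0.
have [/forallP cG|] := boolP [forall x : G, [forall y, connect (@edge G) x y]].
  apply: hc; apply/graph_classP; split=> //; split=> // x.
  exact/forallP.
rewrite negb_forall => /existsP[x]; rewrite negb_forall => /existsP[y nxy].
pose a : pred G := connect (@edge G) x.
have iG : graph_iso (sum_graph (induced a) (induced (predC a))) G.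
  exact: closed_iso_sum (connect_closed (sym_connect_sym (@edge_sym G)) x).
have := fG; rewrite -(feasible_iso mu iG) feasible_sum_graph => -[f1 f2].
have := rG; rewrite -(rank_iso mu iG) rank_sum_graph => r12.
have cE : #|G| = (#|induced a| + #|induced (predC a)|)%N.
  by rewrite !card_induced cardC.
have c1 : (0 < #|induced a|)%N.
  by rewrite card_induced; apply/card_gt0P; exists x; apply: connect0.
have c2 : (0 < #|induced (predC a)|)%N.
  by rewrite card_induced; apply/card_gt0P; exists y.
rewrite natrD mulrDl; have -> : #|G|%:R =
    #|induced a|%:R + #|induced (predC a)|%:R :> R by rewrite cE natrD.
by rewrite lerD // IHn //; lia.
Qed.

(** * Translation between spherical codes and graphs *)

Section Codes.
Variables (R : realType) (d : nat).

(** Since [alpha] and [beta] are below 1, the inner product of a unit vector with itself, such a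
    family is automatically injective. *)
Lemma code_sizesP (alpha beta : R) n : alpha < 1 -> beta < 1 ->
  code_sizes alpha beta d n <-> exists x : 'I_n -> 'cV[R]_d,
    (forall i, dot (x i) (x i) = 1) /\
    (forall i j, i != j -> dot (x i) (x j) = alpha \/ dot (x i) (x j) = beta).
Proof.
move=> a1 b1; split=> [[S [S1 S2] /card_set_bijP[f [fS fI fSurj]]]|[x [x1 x2]]].
  have inv (i : 'I_n) : {v | S v & f v = i}.
    by apply: cid2; have [v Sv fv] := fSurj _ (ltn_ord i); exists v.
  exists (fun i => s2val (inv i)); split=> [i|i j ij].
    exact: S1 (s2valP (inv i)).
  apply: S2 => [||vw]; [exact: s2valP (inv i)|exact: s2valP (inv j)|].
  have /= ei := s2valP' (inv i); have /= ej := s2valP' (inv j).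
  by move/eqP: ij; apply; apply: val_inj; rewrite /= -ei vw ej.
exists (range x).
  split=> [_ [i _ <-] //|_ _ [i _ <-] [j _ <-] xij].
  by apply: x2; apply: contra_notN xij => /eqP ->.
have xI : injective x.
  move=> i j xij; apply/eqP; apply: contraT => /x2.
  by rewrite xij x1; lra.
apply: card_eq_trans (inj_card_eq (in2W xI)) _.
by rewrite card_eq_sym card_II.
Qed.

Lemma dotE (x y : 'cV[R]_d) : dot x y = \sum_k x k 0 * y k 0.
Proof. by rewrite /dot mxE; apply: eq_bigr => k _; rewrite mxE. Qed.

Lemma dotC (x y : 'cV[R]_d) : dot x y = dot y x.
Proof. by rewrite !dotE; apply: eq_bigr => k _; rewrite mulrC. Qed.

(* Vertices are the code vectors, joined when their inner product is alpha, so
   that A + mu I = (Gram - beta J) / (alpha - beta); as beta < 0 this is the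
   Gram matrix of the vectors extended by the coordinate sqrt (- beta). *)
Lemma feasible_of_code (mu alpha beta : R) n :
  admissible mu alpha beta -> code_sizes alpha beta d n ->
  exists G : sgraph,
    [/\ #|G| = n, feasible (shifted mu G) & (\rank (shifted mu G) <= d.+1)%N].
Proof.
case=> muE b1 ba a1 b0 /code_sizesP[//||x [x1 x2]]; first lra.
pose e : rel 'I_n := fun i j => (i != j) && (dot (x i) (x j) == alpha).
have e_sym : symmetric e by move=> i j; rewrite /e eq_sym dotC.
have e_irr : irreflexive e by move=> i; rewrite /e eqxx.
pose G := SGraph e_sym e_irr.
have bG : bijective (id : 'I_n -> G) by exists id.
pose c := Num.sqrt (alpha - beta)^-1.
pose b := Num.sqrt (- beta).
have c0 : 0 < c by rewrite sqrtr_gt0 invr_gt0; lra.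
have b'0 : 0 < b by rewrite sqrtr_gt0; lra.
pose Y : 'M[R]_(n, d + 1) := c *: row_mx (\matrix_(i, k) x i k 0) (const_mx b).
have YE : enum_shifted mu (id : 'I_n -> G) = Y *m Y^T.
  rewrite /Y linearZ /= -scalemxAl -scalemxAr scalerA tr_row_mx mul_row_col.
  rewrite -expr2 sqr_sqrtr ?invr_ge0; last lra.
  apply/matrixP => i j; rewrite !mxE big_ord1 !mxE.
  under eq_bigr do rewrite !mxE.
  rewrite -dotE -expr2 sqr_sqrtr; last lra.
  have ab0 : alpha - beta != 0 by rewrite gt_eqF // subr_gt0.
  rewrite -[edge _ _]/(e i j) /e -muE.
  have [<-|ij] := eqVneq i j; first by rewrite /= x1; field.
  case: (x2 _ _ ij) => -> /=; rewrite ?eqxx /= mulr0n addr0; first by field.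
  by rewrite (lt_eqF ba) /=; field.
exists G; split; first exact: card_ord.
  rewrite -(feasible_enum_shifted mu bG) YE; split; first exact: psd_gram.
  have /submxP[D eD] := gram_colspace Y.
  (* The last column of [Y] is constantly c b, so [Y] sends the second factor to j; and Y Y^T D^T =
     Y by the choice of [D]. *)
  exists (D^T *m col_mx 0 (c^-1 * b^-1)%:M).
  have -> : Y *m Y^T *m (D^T *m col_mx 0 (c^-1 * b^-1)%:M) =
            Y *m col_mx 0 (c^-1 * b^-1)%:M.
    rewrite mulmxA; congr (_ *m _); apply: trmx_inj.
    by rewrite trmx_mul trmxK [in LHS]trmx_mul trmxK -eD.
  rewrite /Y -scalemxAl mul_row_col mulmx0 add0r.
  apply/colP => i; rewrite !mxE big_ord1 !mxE /= mulr1n.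
  by field; rewrite !gt_eqF.
rewrite -(rank_enum_shifted mu bG) YE; apply: leq_trans (mxrankM_maxl _ _) _.
by apply: leq_trans (rank_leq_col _) _; rewrite addn1.
Qed.

(* With j = M w and s = <j, w>, deflating M along w gives M - J / s; it is a
   positive multiple of the Gram matrix of a code for beta = - 1 / (s mu - 1).
   The non-adjacent pair forces s mu >= 2, that is beta >= -1. *)
Lemma code_of_feasible (mu : R) (G : sgraph) (a b : G) :
  1 < mu -> feasible (shifted mu G) -> (\rank (shifted mu G) <= d.+1)%N ->
  a != b -> ~~ edge a b ->
  exists alpha beta : R, admissible mu alpha beta /\
    code_sizes alpha beta d #|G|.
Proof.
move=> mu1 [pM [w Mw]] rM ab nab; set M := shifted mu G in pM Mw rM.
have formw y : form M y w^T = (y *m const_mx 1 : 'M_1) 0 0.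
  by rewrite /form trmxK -mulmxA Mw.
have MEd i : M i i = mu by rewrite shiftedE edge_irr eqxx add0r mulr1n.
pose s := form M w^T w^T.
have s0 : 0 < s.
  (* If s were 0, the form at e_a - mu w would be mu - 2 mu < 0. *)
  rewrite lt_def pM.2 andbT; apply/eqP => s0.
  have := pM.2 (delta_mx 0 (enum_rank a) + (- mu) *: w^T).
  rewrite form_comb ?pM.1 // form_delta MEd -/s s0 formw -rowE !mxE.
  by lra.
have wM : w^T *m M = const_mx 1.
  by apply: trmx_inj; rewrite trmx_mul trmxK pM.1 Mw trmx_const.
have pD := psd_deflate pM s0.
have rD : (\rank (deflate M w^T) <= d)%N.
  by rewrite -ltnS; apply: leq_trans (rank_deflate pM.1 s0) rM.
have DE i j : deflate M w^T i j = M i j - s^-1.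
  by rewrite /deflate trmxK Mw wM !mxE big_ord1 !mxE !mulr1.
(* The deflated form at e_a + e_b equals 2 mu - 4 / s. *)
have smu : 2 <= s * mu.
  have := pD.2 (delta_mx 0 (enum_rank a) + 1 *: delta_mx 0 (enum_rank b)).
  rewrite form_comb ?pD.1 // !form_delta !DE !MEd shifted_rank.
  rewrite (negbTE nab) (negbTE ab) /= mulr0n addr0.
  have e : s * s^-1 = 1 by rewrite divff ?gt_eqF.
  have si : 0 < s^-1 by rewrite invr_gt0.
  nra.
pose t := s * mu - 1; have t1 : 1 <= t by rewrite /t; lra.
have t0 : t != 0 by rewrite gt_eqF //; lra.
have ti : 0 < t^-1 by rewrite invr_gt0; lra.
have tt : t * t^-1 = 1 by rewrite divff.
(* Scaling M - J / s by s / t turns its diagonal entries mu - 1 / s into 1, and its entries 1 - 1 /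
   s and - 1 / s into [alpha] and [beta]. *)
pose beta := - t^-1; pose alpha := beta + s / t.
have stE : s / t * mu = 1 + t^-1 by rewrite /t; field.
have st0 : 0 < s / t by rewrite divr_gt0 //; lra.
have b1 : -1 <= beta by rewrite /beta lerN2 invf_le1 //; lra.
have adm : admissible mu alpha beta.
  split=> //; rewrite /alpha ?ltrDl //.
  - rewrite [beta + s / t]addrC addrK /beta opprK -stE; field.
    by rewrite t0 gt_eqF.
  - by rewrite /beta; nra.
  - by rewrite /beta; lra.
exists alpha, beta; split=> //; case: adm => _ _ _ a1 b0.
apply/code_sizesP; [done|lra|].
have [Y YE] := psd_factor pD rD.
pose x i : 'cV[R]_d := Num.sqrt (s / t) *: (row i Y)^T.
have xE i j : dot (x i) (x j) = s / t * (M i j - s^-1).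
  rewrite -DE YE dotE mxE mulr_sumr; apply: eq_bigr => k _.
  by rewrite !mxE mulrACA -expr2 sqr_sqrtr // ltW.
have s_neq0 : s != 0 by rewrite gt_eqF.
exists x; split=> [i|i j ij]; rewrite xE.
  by rewrite MEd /t; field; rewrite s_neq0.
rewrite shiftedE (inj_eq enum_val_inj) (negbTE ij) addr0 /alpha /beta.
by case: edge => /=; [left|right]; field; rewrite s_neq0 t0.
Qed.

End Codes.

(** * Existence of the maxima, the copies construction and the two bounds *)

Lemma nat_max (A : set nat) N : A !=set0 -> (forall n, A n -> (n <= N)%N) ->
  exists m, is_max A m.
Proof.
move=> [n0 An0] AN.
have exA : exists n, `[< A n >] by exists n0; apply/asboolP.
have bdA n : `[< A n >] -> (n <= N)%N by move/asboolP/AN.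
case: (ex_maxnP exA bdA) => m /asboolP Am mmax.
by exists m; split=> // n /asboolP/mmax.
Qed.

(** The empty code gives a size, and through the associated graphs all sizes are at most 4^(d+1); so
    the default of [max_code] is never taken. *)
Lemma max_codeP (R : realType) (d : nat) (mu alpha beta : R) :
  1 < mu -> admissible mu alpha beta ->
  is_max (code_sizes alpha beta d) (max_code alpha beta d).
Proof.
move=> mu1 adm; apply: xgetPex; apply: (@nat_max _ (4 ^ d.+1)).
  exists 0%N; case: adm => _ _ ba a1 b0; apply/code_sizesP => //; first lra.
  by exists (fun _ => 0); split=> -[].
move=> n /(feasible_of_code adm)[G [<- _ rG]].
by apply: leq_trans (card_le_rank G mu1) _; rewrite leq_pexp2l.
Qed.

Lemma admissible_ex (R : realType) (mu : R) : 1 < mu ->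
  exists alpha beta : R, admissible mu alpha beta.
Proof.
move=> mu1; have mu0 : 0 < mu by lra.
have mui : mu * mu^-1 = 1 by rewrite divff ?gt_eqF.
have mui0 : 0 < mu^-1 by rewrite invr_gt0.
(* For beta = -1 the equation reads 2 / (alpha + 1) = mu, and alpha < 1 amounts to mu > 1. *)
exists (2 / mu - 1), (-1); split; rewrite ?lexx //; try nra.
have -> : 2 / mu - 1 - -1 = 2 / mu by ring.
by field; rewrite gt_eqF.
Qed.

Lemma feasible_complete_graph (R : realType) (mu : R) t : 1 < mu ->
  feasible (shifted mu (complete_graph t)) /\
  \rank (shifted mu (complete_graph t)) = t.
Proof.
move=> mu1; have [|f r] := @feasible_complete _ mu (complete_graph t) mu1.
  by move=> x y.
by split=> //; rewrite r card_ord.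
Qed.

(** Shows that the outer maxima range over nonempty sets. *)
Lemma K1_graph_class (R : realType) (mu : R) r : 1 < mu ->
  graph_class mu r.+1 (complete_graph 1).
Proof.
move=> mu1; have [f rk] := feasible_complete_graph 1 mu1.
apply/graph_classP; split=> //; last by rewrite rk.
split=> [|x y]; first by rewrite card_ord.
by rewrite (ord1 x) (ord1 y) connect0.
Qed.

Lemma iso_complete (G : sgraph) t : #|G| = t ->
  (forall x y : G, x != y -> edge x y) -> graph_iso G (complete_graph t).
Proof.
move=> cG eG; exists (cast_ord cG \o enum_rank).
  apply: bij_comp; last exact: enum_rank_bij.
  by exists (cast_ord (esym cG)) => i; rewrite ?cast_ordK ?cast_ordKV.
move=> x y /=; rewrite (inj_eq (@cast_ord_inj _ _ _)) (inj_eq enum_rank_inj).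
by have [->|xy] := eqVneq x y; [rewrite edge_irr | rewrite eG].
Qed.

Lemma iter_sum_graph (R : realType) (mu : R) (G H : sgraph) k :
  feasible (shifted mu G) -> feasible (shifted mu H) ->
  let K := iter k (sum_graph G) H in
  [/\ #|K| = (k * #|G| + #|H|)%N, feasible (shifted mu K)
    & \rank (shifted mu K) = (k * \rank (shifted mu G) + \rank (shifted mu H))%N].
Proof.
move=> fG fH; elim: k => [|k [cK fK rK]] //=; split.
- by rewrite card_sum cK mulSn addnA.
- exact/feasible_sum_graph.
- by rewrite rank_sum_graph rK mulSn addnA.
Qed.

Lemma code_of_copies (R : realType) (d : nat) (mu : R) (G : sgraph) :
  (0 < d)%N -> 1 < mu -> graph_class mu d.+1 G ->
  ~ graph_iso G (complete_graph d.+1) ->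
  let rk := \rank (shifted mu G) in
  exists alpha beta : R, admissible mu alpha beta /\
    code_sizes alpha beta d
      (d.+1 %/ rk * #|G| + (d.+1 - rk * (d.+1 %/ rk)))%N.
Proof.
move=> d0 mu1 /graph_classP[[G0 _] fG rG] nK rk.
have rk0 : (0 < rk)%N by rewrite rank_shifted_gt0 // gt_eqF //; lra.
set k := (d.+1 %/ rk)%N; set q := (d.+1 - _)%N.
have k0 : (0 < k)%N by rewrite divn_gt0.
have kq : (k * rk + q = d.+1)%N by rewrite mulnC subnKC // mulnC leq_trunc_div.
(* The empty graph, on which the iterated unions start. *)
have [f0 r0] := feasible_complete_graph 0 mu1.
have [f1 r1] := feasible_complete_graph 1 mu1.
have [cQ fQ rQ] := iter_sum_graph q f1 f0.
(* One copy of [G] stays outside [H], so that any vertex of [H] is non-adjacent to any vertex of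
   that copy. *)
have [] := iter_sum_graph k.-1 fG fQ.
set H := iter _ _ _ => cH fH rH.
have {cQ}cH : #|H| = (k.-1 * #|G| + q)%N.
  by rewrite cH cQ !card_ord muln1 addn0.
have {rQ}rH : \rank (shifted mu H) = (k.-1 * rk + q)%N.
  by rewrite rH rQ r1 r0 muln1 addn0.
have kE m : (k * m = m + k.-1 * m)%N by rewrite -mulSn prednK.
have fS : feasible (shifted mu (sum_graph G H)) by apply/feasible_sum_graph.
have rS : (\rank (shifted mu (sum_graph G H)) <= d.+1)%N.
  by rewrite rank_sum_graph rH -kq kE addnA.
have cS : #|sum_graph G H| = (k * #|G| + q)%N by rewrite card_sum cH kE addnA.
rewrite -cS.
have [H0|/card_gt0P[y _]] := posnP #|H|; last first.
  by have /card_gt0P[x _] := G0; apply: (@code_of_feasible _ _ _ (sum_graph G H) (inl x) (inr y)).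
(* With [H] empty, [G] has rank d + 1; were it complete, its number of vertices would equal its
   rank, making it K_(d+1). *)
suff [x [y [xy nxy]]] : exists x y : G, x != y /\ ~~ edge x y.
  exact: (@code_of_feasible _ _ _ (sum_graph G H) (inl x) (inl y)).
apply: contrapT => nxy.
have cG (x y : G) : x != y -> edge x y.
  by move=> xy; apply: contrapT => /negP e; apply: nxy; exists x, y.
apply/nK/iso_complete => //; have [_ <-] := feasible_complete mu1 cG.
have : (\rank (shifted mu H) <= #|H|)%N by exact: rank_leq_row.
rewrite -[\rank (shifted mu G)]/rk -kq kE rH H0; lia.
Qed.

Theorem theorem5p1 (R : realType) (d : nat) (mu : R) :
  (0 < d)%N -> 1 < mu ->
  (forall alpha beta : R, admissible mu alpha beta ->
     is_max (code_sizes alpha beta d) (max_code alpha beta d)) /\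
  exists (m1 m2 : nat) (m3 : R),
    [/\ is_max
          [set n : nat | exists G : sgraph,
             [/\ graph_class mu d.+1 G,
                 ~ graph_iso G (complete_graph d.+1)
               & let rk := \rank (shifted mu G) in
                 let q := (d.+1 - rk * (d.+1 %/ rk))%N in
                 n = (d.+1 %/ rk * #|G| + q)%N]] m1,
        is_max
          [set n : nat | exists alpha beta : R,
             admissible mu alpha beta /\ n = max_code alpha beta d] m2,
        is_max
          [set x : R | exists2 G : sgraph,
             graph_class mu d.+1 G
             & x = #|G|%:R / (\rank (shifted mu G))%:R] m3,
        (m1 <= m2)%N
      & m2%:R <= d.+1%:R * m3].
Proof.
move=> d0 mu1; have mu0 : mu != 0 by rewrite gt_eqF //; lra.
split=> [alpha beta|]; first exact: max_codeP.
have cardB (G : sgraph) : (\rank (shifted mu G) <= d.+1)%N ->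
    (#|G| <= 4 ^ d.+1)%N.
  by move=> rG; apply: leq_trans (card_le_rank G mu1) _; rewrite leq_pexp2l.
have K1 := K1_graph_class d mu1.
have rk0 G : graph_class mu d.+1 G -> (0 < \rank (shifted mu G) <= d.+1)%N.
  by case/graph_classP=> [[G0 _] _ ->]; rewrite rank_shifted_gt0.
set A2 := [set n : nat | exists alpha beta : R, _].
have [m2 m2P] : exists m, is_max A2 m.
  apply: (@nat_max _ (4 ^ d.+1)).
    by have [a [b ab]] := admissible_ex mu1; exists (max_code a b d), a, b.
  move=> _ [a [b [ab ->]]]; have [+ _] := max_codeP d mu1 ab.
  by move/(feasible_of_code ab) => [G [<- _]]; apply: cardB.
set A1 := [set n : nat | exists G : sgraph, _].
(* The lower bound, proved first because it also bounds [A1] and so yields its maximum. *)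
have A1le n : A1 n -> (n <= m2)%N.
  move=> [G [cG nK ->]]; have [a [b [ab nab]]] := code_of_copies d0 mu1 cG nK.
  apply: leq_trans (m2P.2 _ (ex_intro _ a (ex_intro _ b (conj ab erefl)))).
  exact: (max_codeP d mu1 ab).2.
have [m1 m1P] : exists m, is_max A1 m.
  apply: (@nat_max _ m2) => //.
  (* K_1 differs from K_(d+1) because d > 0. *)
  eexists; exists (complete_graph 1); split=> // -[f [g gK fK] _].
  have := bij_eq_card (Bijective gK fK).
  by rewrite !card_ord => -[] d0'; rewrite -d0' in d0.
(* Multiplying by (d + 1)! turns the ratios into natural numbers. *)
pose F := (d.+1)`!%N.
pose A3 := [set n : nat | exists2 G : sgraph, graph_class mu d.+1 G
  & n = (#|G| * (F %/ \rank (shifted mu G)))%N].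
have ratioE G : graph_class mu d.+1 G -> #|G|%:R / (\rank (shifted mu G))%:R =
    (#|G| * (F %/ \rank (shifted mu G)))%:R / F%:R :> R.
  move=> /rk0 rkG; have /andP[rG0 _] := rkG.
  have := divnK (dvdn_fact rkG); rewrite -/F; move: (F %/ _)%N => f fE.
  have f0 : f != 0%N by apply: contraTneq (fact_gt0 d.+1) => f0; rewrite -/F -fE f0.
  by rewrite -fE !natrM; field; rewrite !pnatr_eq0 f0 -lt0n rG0.
have [m3 [[G3 cG3 m3E] m3ub]] : exists m, is_max A3 m.
  apply: (@nat_max _ (4 ^ d.+1 * F)); first by eexists; exists (complete_graph 1).
  move=> _ [G cG ->]; have /andP[_ rG] := rk0 _ cG.
  by rewrite leq_mul ?leq_div ?cardB.
have F0 : 0 < F%:R :> R by rewrite ltr0n fact_gt0.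
have m3P (G : sgraph) : graph_class mu d.+1 G ->
    #|G|%:R / (\rank (shifted mu G))%:R <= m3%:R / F%:R :> R.
  move=> cG; rewrite ratioE // ler_pM2r ?invr_gt0 // ler_nat.
  by apply: m3ub; exists G.
exists m1, m2, (m3%:R / F%:R); split=> //.
- split=> [|_ [G cG ->]]; last exact: m3P.
  by exists G3 => //; rewrite ratioE // m3E.
- exact: A1le m1P.1.
(* The graph of a largest code satisfies |V| <= rank * m3 / F by summing over components, and its
   rank is at most d + 1. *)
case: m2P => -[a [b [ab ->]]] _.
have [/(feasible_of_code ab)[G [<- fG rG]] _] := max_codeP d mu1 ab.
have c0 : 0 <= m3%:R / F%:R :> R by rewrite divr_ge0.
apply: le_trans (feasible_card c0 _ fG rG) _ => [H cH|].
  have /andP[rH _] := rk0 _ cH.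
  by rewrite mulrC -ler_pdivrMr ?ltr0n // m3P.
by rewrite ler_wpM2r // ler_nat.
Qed.
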